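(* Consider one step with remaining support $r=(r_{k,m})$ and one integer target $\hat h$ of mass $B_t$, as in the context. Suppose that every requested class (every $m$ with $\hat h_m>0$) has the same eligible client set $\{k\in\mathcal K: r_{k,m}>0\}$, and that no class-specific support count (the limits $r_{k,m}$ in $q_{k,m}\le r_{k,m}$) can bind within that target. If every $\tau_k(b)$ is nondecreasing in $b$, then Fast LB-GPSL (described in the context) attains the minimum current-step modeled client-side time, i.e. the minimum of $T_{\mathrm{client}}(q)=\max_{k\in\mathcal K}\tau_k\big(\sum_m q_{k,m}\big)$ over all integer assignments $q$ with $0\le q_{k,m}\le r_{k,m}$ and $\sum_kq_{k,m}=\hat h_m$ for all $m\in\mathcal M$.
   Context: Clients $\mathcal K=\{1,\dots,K\}$, classes $\mathcal M=\{1,\dots,M\}$. $r_{k,m}\in\mathbb Z_{\ge0}$ is the unused class-$m$ support at client $k$ before the step; client $k$ is eligible for class $m$ while it has unused class-$m$ support. $R_m=\sum_k r_{k,m}$, $R=\sum_m R_m\ge1$, $B_t=\min\{B,R\}$ with $B\ge1$ an integer. The target $\hat h$ is an integer vector with $\sum_m\hat h_m=B_t$ and $\hat h_m\in\{\lfloor B_tR_m/R\rfloor,\lceil B_tR_m/R\rceil\}$ for each $m$. The predicted client-side time of client $k$ for a local batch of $b$ examples is $\tau_k(b)=\mathbf 1\{b>0\}(a_k+c_kb^\gamma)$, with parameters $a_k$ (batch-independent cost), $c_k$ (coefficient of the batch-dependent cost) and $\gamma$ (fitted exponent). Fast LB-GPSL, for one step: expand the target into a randomized sequence of $B_t$ classes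 in which class $m$ appears exactly $\hat h_m$ times. Start with $b_k=0$ and $q_{k,m}=0$. Process the sequence in order; for each requested class $m$, consider the clients that still have unused class-$m$ support ($q_{k,m}<r_{k,m}$), choose among them the client $k$ minimizing the predicted next completion $\tau_k(b_k+1)$, and increase $q_{k,m}$ and $b_k$ by one. Exact ties in the next completion favor the client that has contributed less relative to its pooled share so far (pooled share: the client's fraction of all examples across clients), and remaining ties are broken by client index. *)

(* Defs.v *)
From HB Require Import structures.
From mathcomp Require Import all_boot all_order all_algebra.
From mathcomp Require Import reals exp.

Set Implicit Arguments.
Unset Strict Implicit.
Unset Printing Implicit Defensive.

Import Order.TTheory GRing.Theory Num.Theory.

Local Open Scope ring_scope.

(* Counts indexed by (client, class). *)
Definition counts (K M : nat) := 'I_K -> 'I_M -> nat.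

Definition class_support K M (r : counts K M) (m : 'I_M) : nat :=
  (\sum_(k < K) r k m)%N.

Definition total_support K M (r : counts K M) : nat :=
  (\sum_(m < M) class_support r m)%N.

Definition step_budget K M (B : nat) (r : counts K M) : nat :=
  minn B (total_support r).

(* Floor and ceiling of a nonnegative rational: a target is a vector of
   naturals without loss of generality. *)
Definition is_target K M (B : nat) (r : counts K M) (h : 'I_M -> nat) : Prop :=
  (\sum_(m < M) h m)%N = step_budget B r /\
  forall m : 'I_M,
    let x : rat := (step_budget B r * class_support r m)%N%:R
                     / (total_support r)%:R in
    (h m)%:Z = Num.floor x \/ (h m)%:Z = Num.ceil x.

Definition client_time (R : realType) K (a c : 'I_K -> R) (gamma : R)
    (k : 'I_K) (b : nat) : R :=
  (0 < b)%N%:R * (a k + c k * b%:R `^ gamma).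

Definition batch K M (q : counts K M) (k : 'I_K) : nat :=
  (\sum_(m < M) q k m)%N.

(* The maximum is seeded with 0, which leaves it unchanged when each [tau k] is
   nondecreasing with [tau k 0 = 0], as then every term is nonnegative. *)
Definition T_client (R : realType) K M (tau : 'I_K -> nat -> R)
    (q : counts K M) : R :=
  \big[Num.max/0]_(k < K) tau k (batch q k).

Definition feasible K M (r : counts K M) (h : 'I_M -> nat) (q : counts K M) :
    Prop :=
  (forall k m, (q k m <= r k m)%N) /\
  (forall m, (\sum_(k < K) q k m)%N = h m).

Definition minimizes_T_client (R : realType) K M (tau : 'I_K -> nat -> R)
    (r : counts K M) (h : 'I_M -> nat) (q : counts K M) : Prop :=
  feasible r h q /\
  forall q', feasible r h q' -> T_client tau q <= T_client tau q'.

Definition eligible_set K M (r : counts K M) (m : 'I_M) : {set 'I_K} :=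
  [set k | (0 < r k m)%N].

(* However the target, or any part of it, is spread over eligible clients, the
   limits [r k m] are respected, i.e., they only exclude ineligible clients. *)
Definition supports_cannot_bind K M (r : counts K M) (h : 'I_M -> nat) : Prop :=
  forall q : counts K M,
    (forall k m, (0 < q k m)%N -> k \in eligible_set r m) ->
    (forall m, (\sum_(k < K) q k m <= h m)%N) ->
    forall k m, (q k m <= r k m)%N.

(* [used k] counts the examples client [k] contributed in earlier steps; with
   the unused support [r] they make up all the examples of client [k]. *)
Definition client_size K M (used : 'I_K -> nat) (r : counts K M) (k : 'I_K) :
    nat :=
  (used k + \sum_(m < M) r k m)%N.

Definition pooled_share (R : realType) K M (used : 'I_K -> nat)
    (r : counts K M) (k : 'I_K) : R :=
  (client_size used r k)%:R / (\sum_(j < K) client_size used r j)%N%:R.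

(* Contribution so far (earlier steps and current one) over pooled share, which
   is positive for a client with unused support. *)
Definition relative_contribution (R : realType) K M (used : 'I_K -> nat)
    (r q : counts K M) (k : 'I_K) : R :=
  (used k + batch q k)%N%:R / pooled_share R used r k.

Definition preferred (R : realType) K M (tau : 'I_K -> nat -> R)
    (used : 'I_K -> nat) (r q : counts K M) (k j : 'I_K) : bool :=
  let t i := tau i (batch q i).+1 in
  let s i := relative_contribution R used r q i in
  (t k < t j) ||
  ((t k == t j) && ((s k < s j) || ((s k == s j) && (k <= j)%N))).

Definition next_client (R : realType) K M (tau : 'I_K -> nat -> R)
    (used : 'I_K -> nat) (r q : counts K M) (m : 'I_M) : option 'I_K :=
  [pick k | (q k m < r k m)%N &
     [forall j, (q j m < r j m)%N ==> preferred tau used r q k j]].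

Definition incr_count K M (q : counts K M) (k : 'I_K) (m : 'I_M) : counts K M :=
  fun k' m' => (q k' m' + ((k' == k) && (m' == m)))%N.

(* A request that no client can serve is dropped; the result is then not
   [feasible]. *)
Definition lb_gpsl_step (R : realType) K M (tau : 'I_K -> nat -> R)
    (used : 'I_K -> nat) (r q : counts K M) (m : 'I_M) : counts K M :=
  if next_client tau used r q m is Some k then incr_count q k m else q.

Definition fast_lb_gpsl (R : realType) K M (tau : 'I_K -> nat -> R)
    (used : 'I_K -> nat) (r : counts K M) (s : seq 'I_M) : counts K M :=
  foldl (lb_gpsl_step tau used r) (fun _ _ => 0%N) s.

(* The possible outcomes of the random expansion of the target. *)
Definition is_expansion M (h : 'I_M -> nat) (s : seq 'I_M) : Prop :=
  forall m, count_mem m s = h m.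

(* Main.v *)
Require Import Defs.
From HB Require Import structures.
From mathcomp Require Import all_boot all_order all_algebra.
From mathcomp Require Import reals exp.
Import Order.TTheory GRing.Theory Num.Theory.
Local Open Scope ring_scope.

(** When the supports cannot bind, every request can be served by all of a fixed
    set of clients, so after each greedy step the time of any client in use is at
    most the next completion time of any eligible client. If an assignment of
    the same total mass were strictly faster, the greedy bottleneck client would
    hold more than in that assignment, hence some eligible client [j] would hold
    less; its next completion, at least the greedy bottleneck time, would
    then be at most the time of [j] in the faster assignment. *)

Lemma class_count_incr K M (q : counts K M) k m m' :
  (\sum_(i < K) incr_count q k m i m' = \sum_(i < K) q i m' + (m' == m))%N.
Proof.
rewrite big_split /=; congr addn; rewrite (bigD1 k) //= eqxx big1 ?addn0 //.
by move=> i /negbTE ->.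
Qed.

Lemma batch_incr K M (q : counts K M) k m k' :
  (batch (incr_count q k m) k' = batch q k' + (k' == k))%N.
Proof.
rewrite /batch big_split /=; congr addn.
rewrite (bigD1 m) //= eqxx andbT big1 ?addn0 // => i /negbTE ->.
by rewrite andbF.
Qed.

Lemma sum_batch K M (q : counts K M) :
  (\sum_(k < K) batch q k = \sum_(m < M) \sum_(k < K) q k m)%N.
Proof. exact: exchange_big. Qed.

Lemma batch_le_T_client (R : realType) K M (tau : 'I_K -> nat -> R)
    (q : counts K M) k : tau k (batch q k) <= T_client tau q.
Proof. exact: (le_bigmax _ (fun i => tau i (batch q i))). Qed.

Section Preferred.
Context (R : realType) (K M : nat) (tau : 'I_K -> nat -> R).
Context (used : 'I_K -> nat) (r q : counts K M).
Let pref := preferred tau used r q.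

Lemma preferred_refl : reflexive pref.
Proof. by move=> k; rewrite /pref /preferred !eqxx leqnn !orbT. Qed.

Lemma preferred_total : total pref.
Proof.
move=> k j; rewrite /pref /preferred.
case: ltgtP => //= _; case: ltgtP => //= _; exact: leq_total.
Qed.

Lemma preferred_trans : transitive pref.
Proof.
move=> j k i; rewrite /pref /preferred.
move=> /orP[tkj|/andP[/eqP-> skj]] /orP[tji|/andP[/eqP<- sji]].
- by rewrite (lt_trans tkj tji).
- by rewrite tkj.
- by rewrite tji.
rewrite eqxx ltxx /=; move: skj sji.
move=> /orP[skj|/andP[/eqP-> lkj]] /orP[sji|/andP[/eqP<- lji]].
- by rewrite (lt_trans skj sji).
- by rewrite skj.
- by rewrite sji.
by rewrite eqxx (leq_trans lkj lji) orbT.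
Qed.

Lemma preferred_le_time k j :
  pref k j -> tau k (batch q k).+1 <= tau j (batch q j).+1.
Proof. by case/orP => [/ltW|/andP[/eqP-> _]]. Qed.

Lemma next_clientP m j : (q j m < r j m)%N ->
  exists k, [/\ next_client tau used r q m = Some k, (q k m < r k m)%N &
    forall i, (q i m < r i m)%N -> tau k (batch q k).+1 <= tau i (batch q i).+1].
Proof.
move=> qj; rewrite /next_client; case: pickP => [k /andP[qk /forallP kmin]|none].
  exists k; split=> // i qi; apply: preferred_le_time.
  exact: (implyP (kmin i)).
have [k qk kmin] := @extremumP _ _ pref j (fun i => q i m < r i m)%N id
  preferred_refl preferred_trans preferred_total qj.
move/negP: (none k) => []; rewrite qk.
by apply/forallP => i; apply/implyP; apply: kmin.
Qed.

End Preferred.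

Section Greedy.
Context (R : realType) (K M : nat) (tau : 'I_K -> nat -> R).
Context (used : 'I_K -> nat) (r : counts K M) (h : 'I_M -> nat).
Hypothesis tau_mono :
  forall k b b', (b <= b')%N -> tau k b <= tau k b'.
Hypothesis same_eligible : forall m m', (0 < h m)%N -> (0 < h m')%N ->
  eligible_set r m = eligible_set r m'.
Hypothesis nonbinding : supports_cannot_bind r h.
Hypothesis served : forall m, (0 < h m)%N -> exists k, (0 < r k m)%N.

(** The greedy invariant. Asking for a nonempty batch of [k] makes it vacuous at the start, where
    [tau k 0] and [tau j 1] need not be comparable. *)
Definition balanced (q : counts K M) := forall k j m,
  (0 < h m)%N -> (0 < r j m)%N -> (0 < batch q k)%N ->
  tau k (batch q k) <= tau j (batch q j).+1.

(** Adding one more class-[m] example at [k] stays within the target, so [nonbinding] applies to the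
    enlarged assignment and leaves room for it. *)
Lemma eligible_unsaturated (q : counts K M) m k :
  (forall k m, (q k m <= r k m)%N) ->
  (forall m, (\sum_(k < K) q k m <= h m)%N) ->
  (\sum_(k < K) q k m < h m)%N -> (0 < r k m)%N -> (q k m < r k m)%N.
Proof.
move=> qr qh qm rk.
have := nonbinding (incr_count q k m) _ _ k m.
rewrite {3}/incr_count !eqxx addn1; apply=> [i m'|m'].
  rewrite inE /incr_count; case: eqP => [->|_]; case: eqP => [->|_] //=;
  by rewrite addn0 => /leq_trans; apply.
by rewrite class_count_incr; case: eqP => [->|_]; rewrite ?addn1 ?addn0.
Qed.

(** Only the time of [k] changes, to a value chosen minimal among the next completions for class
    [m]; [same_eligible] carries this over to every requested class. By monotonicity the next
    completions on the right can only grow. *)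
Lemma balanced_incr q m k : balanced q ->
  (forall i, (0 < r i m)%N -> tau k (batch q k).+1 <= tau i (batch q i).+1) ->
  (0 < h m)%N -> balanced (incr_count q k m).
Proof.
move=> qbal kmin hm i j m' hm' rj; rewrite !batch_incr.
have jm : (0 < r j m)%N.
  by have := same_eligible m m' hm hm' => /setP /(_ j); rewrite !inE rj.
have next_le : tau j (batch q j).+1 <= tau j (batch q j + (j == k)).+1.
  by apply: tau_mono; rewrite ltnS leq_addr.
case: (i =P k) => [->|_]; rewrite ?addn1 ?addn0 => bi.
  exact: le_trans (kmin j jm) next_le.
exact: le_trans (qbal i j m' hm' rj bi) next_le.
Qed.

(** Allowing a sequence that falls short of the target lets the induction run over prefixes. *)
Lemma fast_lb_gpsl_invariant s : (forall m, (count_mem m s <= h m)%N) ->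
  let q := fast_lb_gpsl tau used r s in
  [/\ forall k m, (q k m <= r k m)%N,
      forall m, (\sum_(k < K) q k m)%N = count_mem m s & balanced q].
Proof.
elim/last_ind: s => [_|s m IH hs] /=.
  split=> // [m|k j m _ _]; first by rewrite big1.
  by rewrite /batch big1.
have cnt m' : count_mem m' (rcons s m) = (count_mem m' s + (m' == m))%N.
  by rewrite -cats1 count_cat /= addn0 eq_sym.
have hs' m' : (count_mem m' s <= h m')%N.
  by apply: leq_trans (hs m'); rewrite cnt leq_addr.
have /= := IH hs'; rewrite /fast_lb_gpsl foldl_rcons -/(fast_lb_gpsl _ _ _ s).
set q := fast_lb_gpsl _ _ _ s => -[qr qs qbal].
(* The pending request itself provides the strict slack that [eligible_unsaturated] needs. *)
have hm : (count_mem m s < h m)%N by have := hs m; rewrite cnt eqxx addn1.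
have hm0 : (0 < h m)%N by apply: leq_trans hm.
have unsat i : (0 < r i m)%N -> (q i m < r i m)%N.
  by apply: eligible_unsaturated => // [m'|]; rewrite qs.
have [j rj] := served m hm0.
have [k [eqk qk kmin]] := next_clientP R K M tau used r q m j (unsat j rj).
rewrite /lb_gpsl_step eqk; split=> [i m'|m'|].
- rewrite /incr_count; case: (i =P k) => [->|_]; case: (m' =P m) => [->|_] /=;
  by rewrite ?addn1 ?addn0.
- by rewrite class_count_incr qs cnt.
- by apply: balanced_incr => // i ri; apply: kmin; apply: unsat.
Qed.

Lemma balanced_minimizes q : feasible r h q -> balanced q ->
  minimizes_T_client tau r h q.
Proof.
move=> qfeas qbal; split=> // q' [q'r q'h]; have [_ qh] := qfeas.
rewrite {1}/T_client; apply: bigmax_le => [|k _].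
  (* The seed [0] of the maximum has to be bounded as well. *)
  by rewrite /T_client; elim/big_rec: _ => // i x _ x0; rewrite le_max x0 orbT.
have [le_k|lt_k] := leqP (batch q k) (batch q' k).
  exact: le_trans (tau_mono _ _ _ le_k) (batch_le_T_client R K M tau q' k).
(* Both assignments have total mass equal to that of [h], so an excess at [k] is compensated by a
   deficit elsewhere. *)
have [j lt_j] : exists j, (batch q j < batch q' j)%N.
  apply/existsP; apply: contraLR lt_k; rewrite negb_exists -leqNgt => /forallP le'.
  have le_all i : (batch q' i <= batch q i)%N by rewrite leqNgt.
  have : (\sum_(i < K) batch q i = \sum_(i < K) batch q' i)%N.
    by rewrite (sum_batch _ _ q) (sum_batch _ _ q'); apply: eq_bigr => m _; rewrite qh q'h.
  rewrite (bigD1 k) //= [RHS](bigD1 k) //= => eq_sum.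
  rewrite -(leq_add2r (\sum_(i < K | i != k) batch q i)) eq_sum leq_add2l.
  exact: leq_sum.
(* A class that [q'] places on [j] is requested and has [j] eligible, which is what [balanced] asks
   of [j]. *)
have [m q'm] : exists m, (0 < q' j m)%N.
  apply/existsP; apply: contraLR lt_j; rewrite negb_exists -leqNgt => /forallP q0.
  by rewrite /batch big1 // => m _; apply/eqP; rewrite -leqn0 leqNgt.
have hm : (0 < h m)%N by rewrite -q'h (bigD1 j) //= ltn_addr.
have rj : (0 < r j m)%N := leq_trans q'm (q'r j m).
apply: le_trans (qbal k j m hm rj (leq_ltn_trans (leq0n _) lt_k)) _.
exact: le_trans (tau_mono _ _ _ lt_j) (batch_le_T_client R K M tau q' j).
Qed.

End Greedy.

(** A class without support has quota 0, whose floor and ceiling are both 0. *)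
Lemma is_target_served K M B (r : counts K M) h m :
  is_target B r h -> (0 < h m)%N -> exists k, (0 < r k m)%N.
Proof.
move=> [_ /(_ m) /= hm] h0; apply/existsP; move: h0; apply: contraLR.
rewrite negb_exists -leqNgt leqn0 => /forallP r0.
have r_m0 : class_support r m = 0%N.
  by rewrite /class_support big1 // => k _; apply/eqP; rewrite -leqn0 leqNgt.
by move: hm; rewrite r_m0 muln0 mul0r floor0 ceil0 => -[] [->].
Qed.

Theorem proposition5 (R : realType) (K M : nat)
  (r : counts K M) (B : nat) (h : 'I_M -> nat)
  (a c : 'I_K -> R) (gamma : R)
  (used : 'I_K -> nat) (s : seq 'I_M)
  (HR : (1 <= total_support r)%N) (HB : (1 <= B)%N)
  (Hh : is_target B r h)
  (Hs : is_expansion h s)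
  (Helig : forall m m' : 'I_M, (0 < h m)%N -> (0 < h m')%N ->
     eligible_set r m = eligible_set r m')
  (Hbind : supports_cannot_bind r h)
  (Hmono : forall (k : 'I_K) (b b' : nat), (b <= b')%N ->
     client_time a c gamma k b <= client_time a c gamma k b') :
  minimizes_T_client (client_time a c gamma) r h
    (fast_lb_gpsl (client_time a c gamma) used r s).
Proof.
have served m : (0 < h m)%N -> exists k, (0 < r k m)%N.
  exact: is_target_served Hh.
have s_le m : (count_mem m s <= h m)%N by rewrite Hs.
have [qr qs qbal] := fast_lb_gpsl_invariant R K M _ used r h
  Hmono Helig Hbind served s s_le.
apply: balanced_minimizes => //.
by split=> // m; rewrite qs Hs.
Qed.
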